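(* Let $S$ be a holomorphic semigroup, and let $\beta S$ be the set of all ultrafilters on $S$. For $A\subseteq S$ put $\overline{A} = \{\mathscr{F}\in\beta S : A\in\mathscr{F}\}$. Then $\beta S$ is a topological space with the topology $\tau$ having $\mathscr{B}=\{\overline{A} : A\subseteq S\}$ as a basis (i.e. $\mathscr{B}$ is a basis of a topology, $\tau$ being the collection of all unions of members of $\mathscr{B}$), and $(\beta S,\tau)$ is a compact Hausdorff space.
   Context: A holomorphic semigroup $S$ is a non-empty set of holomorphic self-maps of a fixed set $X$ (where $X$ is $\mathbb{C}$, the Riemann sphere $\mathbb{C}_\infty$, or a fixed open subset thereof) that is closed under composition. A filter on $S$ is a non-empty family $\mathscr{F}$ of subsets of $S$ such that $\emptyset\notin\mathscr{F}$; $A\in\mathscr{F}$ and $A\subseteq B \subseteq S$ imply $B\in\mathscr{F}$; and $A,B\in\mathscr{F}$ imply $A\cap B\in\mathscr{F}$. A filter $\mathscr{F}$ is an ultrafilter if whenever $S = A_1\cup\dots\cup A_n$ for some $n\in\mathbb{N}$ and subsets $A_i \subseteq S$, then $A_i\in\mathscr{F}$ for some $1\le i\le n$; equivalently, for every $E\subseteq S$ either $E\in\mathscr{F}$ or $S\setminus E\in\mathscr{F}$. *)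

(* Defs.v *)
From HB Require Import structures.
From mathcomp Require Import all_boot all_order all_algebra.
From mathcomp Require Import complex.
From mathcomp Require Import all_classical all_reals all_analysis.

Set Implicit Arguments.
Unset Strict Implicit.
Unset Printing Implicit Defensive.

Import numFieldNormedType.Exports.
Local Open Scope classical_set_scope.
Local Open Scope ring_scope.
Local Open Scope complex_scope.

Section RiemannSphere.
Variable R : realType.

(* The complex plane as a normed space over itself, so that [derivable] means
   complex differentiability. *)
Definition Cplane : normedModType R[i] := (R[i])^o.

Definition Csphere : topologicalType := one_point_compactification Cplane.

(* [z |-> 1 / z] on the sphere; an involution exchanging 0 and infinity. *)
Definition sphere_inv (p : Csphere) : Csphere :=
  match p with
  | Some z => if z == 0 :> R[i] then None else Some ((z : R[i])^-1)
  | None => Some 0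
  end.

Definition chart (p : Csphere) : Csphere -> Csphere :=
  if p is Some _ then id else sphere_inv.

(* The value at infinity is irrelevant. *)
Definition affine_coord (p : Csphere) : Cplane := if p is Some z then z else 0.

(* [f], extended by infinity outside of [X], read in the charts around [x] and
   [f x]; the charts are involutions, hence their own inverses. *)
Definition local_rep (X : set Csphere) (f : X -> X) (x : X) :
  Cplane -> Cplane :=
  fun z => affine_coord (chart (set_val (f x))
    (valL_ None (set_val \o f) (chart (set_val x) (Some z)))).

(* Meant for open [X]. Continuity is not redundant: as [affine_coord] sends
   infinity to 0, differentiability of [local_rep] alone does not give it. *)
Definition holomorphic (X : set Csphere) (f : X -> X) :=
  continuous f /\
  forall x : X,
    derivable (local_rep f x) (affine_coord (chart (set_val x) (set_val x))) 1.

Definition holomorphic_semigroup (X : set Csphere) (S : set (X -> X)) :=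
  [/\ S !=set0,
      forall f, S f -> holomorphic f &
      forall f g, S f -> S g -> S (f \o g)].

End RiemannSphere.

(* [UltraFilter] of the library is defined by maximality instead. *)
Definition ultrafilter (T : Type) (F : set_system T) :=
  ProperFilter F /\
  forall (n : nat) (A : 'I_n.+1 -> set T),
    \bigcup_i A i = setT -> exists i, F (A i).

Definition beta (T : Type) : Type := {F : set_system T | ultrafilter F}.

Definition beta_bar (T : Type) (A : set T) : set (beta T) :=
  [set F | sval F A].

Definition beta_base (T : Type) : set (set (beta T)) :=
  range (@beta_bar T).

(* The subfamily may be empty, so [set0] is such a union. *)
Definition unions_of (T : Type) (B : set (set T)) : set (set T) :=
  [set \bigcup_(U in D) U | D in [set D | D `<=` B]].

(* Main.v *)
(** An ultrafilter [G] on [beta S] converges to the ultrafilter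
    [{A | G (beta_bar A)}], whence compactness. Distinct ultrafilters differ on
    some [A], and are then separated by the disjoint open sets [beta_bar A] and
    [beta_bar (~` A)]. *)

Require Import Defs.
From HB Require Import structures.
From mathcomp Require Import all_boot all_order all_algebra.
From mathcomp Require Import complex.
From mathcomp Require Import all_classical all_reals all_analysis.
Import numFieldNormedType.Exports.
Local Open Scope classical_set_scope.

(** The covering condition is applied to the two-set cover by [A] and its complement, indexed by
    ['I_2]. *)
Lemma ultrafilterC {T : Type} {F : set_system T} (A : set T) :
  ultrafilter F -> F A \/ F (~` A).
Proof.
case=> _ /(_ 1%N (fun i => if i == ord0 then A else ~` A)) [|i].
  rewrite -subTset => x _; have [Ax|nAx] := pselect (A x).
    by exists ord0.
  by exists ord_max.
by case: ifP; [left|right].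
Qed.

(** If no [A i] were in [F], maximality would put every complement in [F]; so would be their finite
    intersection, which then has a point outside the cover. This makes the covering condition
    available for the ultrafilters tested by [compact_ultra]. *)
Lemma UltraFilter_ultrafilter {T : Type} {F : set_system T} :
  UltraFilter F -> ultrafilter F.
Proof.
move=> FU; split; first exact: ultra_proper.
move=> n A AT; apply: contrapT => /forallNP nFA.
have FC i : F (~` A i) by have [/nFA|] := in_ultra_setVsetC (A i) FU.
have [x xA] := filter_ex (filter_forall _ FC).
by have [i _ /xA] : (\bigcup_i A i) x by rewrite AT.
Qed.

Section StoneTopology.
Variable T : Type.
Implicit Types (A : set T) (p q : beta T).

Let beta_proper p : ProperFilter (sval p) := (svalP p).1.
#[local] Existing Instance beta_proper.

Lemma beta_eq p q : sval p `<=` sval q -> p = q.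
Proof.
move=> pq; apply: eq_sig_hprop => [*|]; first exact: Prop_irrelevance.
apply/seteqP; split=> // A qA.
have [//|/pq qCA] := ultrafilterC A (svalP p).
by have [x []] := filter_ex (filterI qA qCA).
Qed.

Lemma beta_barT : beta_bar (@setT T) = setT.
Proof. by rewrite -subTset => p _; exact: filterT. Qed.

Lemma beta_barI A B : beta_bar (A `&` B) = beta_bar A `&` beta_bar B.
Proof.
apply/seteqP; split=> p.
  by move=> pAB; split; move: pAB; apply: filterS => x [].
by move=> [pA pB]; exact: filterI.
Qed.

Lemma beta_barS A B : A `<=` B -> beta_bar A `<=` beta_bar B.
Proof. by move=> AB p; exact: filterS. Qed.

Lemma beta_bar0 : beta_bar (@set0 T) = set0.
Proof.
by rewrite -subset0 => p p0; have [x] := filter_ex p0.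
Qed.

(** Replaces the unspecified subfamily by a condition at each point, for which the axioms of open
    sets are easy to check. *)
Lemma beta_baseP (U : set (beta T)) :
  unions_of (@beta_base T) U <->
  forall p, U p -> exists2 A, sval p A & beta_bar A `<=` U.
Proof.
split=> [[D DB <-] p [V DV Vp]|UP].
  have [A _ AV] := DB _ DV; exists A; first by rewrite -AV in Vp.
  by rewrite AV => q Vq; exists V.
(* The largest candidate subfamily: all basic sets inside [U]. *)
exists [set V | @beta_base T V /\ V `<=` U]; first by move=> V [].
apply/seteqP; split=> [p [V [_]]|p /UP[A pA AU]]; first exact.
by exists (beta_bar A) => //; split=> //; exists A.
Qed.

Let openT : unions_of (@beta_base T) setT.
Proof. by apply/beta_baseP => p _; exists setT => //; exact: filterT. Qed.

Let openI (U V : set (beta T)) : unions_of (@beta_base T) U ->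
  unions_of (@beta_base T) V -> unions_of (@beta_base T) (U `&` V).
Proof.
move=> /beta_baseP oU /beta_baseP oV; apply/beta_baseP => p [Up Vp].
have [A pA AU] := oU _ Up; have [B pB BV] := oV _ Vp.
by exists (A `&` B); [exact: filterI | rewrite beta_barI; exact: setISS].
Qed.

Let open_bigU (I : Type) (f : I -> set (beta T)) :
  (forall i, unions_of (@beta_base T) (f i)) ->
  unions_of (@beta_base T) (\bigcup_i f i).
Proof.
move=> fo; apply/beta_baseP => p [i _ fp].
have /beta_baseP/(_ _ fp)[A pA Af] := fo i.
by exists A => // q /Af fq; exists i.
Qed.

HB.instance Definition _ := gen_eqMixin (beta T).
HB.instance Definition _ := gen_choiceMixin (beta T).
HB.instance Definition _ :=
  isOpenTopological.Build (beta T) openT openI open_bigU.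

Lemma open_betaE : @open (beta T) = unions_of (@beta_base T).
Proof. by []. Qed.

Lemma nbhs_beta_bar {p A} : sval p A -> nbhs p (beta_bar A).
Proof.
move=> pA; apply: open_nbhs_nbhs; split=> //.
by rewrite open_betaE; apply/beta_baseP => q qA; exists A.
Qed.

Lemma hausdorff_beta : hausdorff_space (beta T).
Proof.
move=> p q pq; apply: beta_eq => A pA.
have [//|qCA] := ultrafilterC A (svalP q).
(* [pq] says that any neighbourhoods of [p] and [q] meet. *)
have := pq _ _ (nbhs_beta_bar pA) (nbhs_beta_bar qCA).
by rewrite -beta_barI setICr beta_bar0 => -[].
Qed.

Lemma compact_beta : compact [set: beta T].
Proof.
rewrite compact_ultra => G GU _.
have [GF G_ultra] := UltraFilter_ultrafilter GU.
have mG_ultra : ultrafilter [set A | G (beta_bar A)].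
  split; first split => /=.
  - by rewrite beta_bar0; exact: filter_not_empty.
  - split=> /=.
    + by rewrite beta_barT; exact: filterT.
    + by move=> A B GA GB /=; rewrite beta_barI; exact: filterI.
    + by move=> A B AB /=; apply: filterS; exact: beta_barS.
  (* Each point of [beta T] is itself an ultrafilter, so it contains some [A i]: the sets
     [beta_bar (A i)] cover [beta T], and [G] picks one of them. *)
  - move=> n A AT; apply: G_ultra; rewrite -subTset => p _.
    by have [i pAi] := (svalP p).2 n A AT; exists i.
exists (exist _ _ mG_ultra); split=> // V.
rewrite nbhsE => -[U [+ Up] UV].
(* At the candidate limit, [A] being a member unfolds to [G (beta_bar A)]. *)
rewrite open_betaE => /beta_baseP/(_ _ Up)[A GA AU].
by apply: (@filterS _ G) GA; exact: subset_trans UV.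
Qed.

End StoneTopology.

Theorem theorem3p1 (R : realType) (X : set (Csphere R)) (S : set (X -> X)) :
  open X -> holomorphic_semigroup S ->
  exists tau : Topological (beta S),
    let betaS : topologicalType := Topological.Pack tau in
    [/\ @open betaS = unions_of (beta_base (T := S)),
        compact [set: betaS]
      & hausdorff_space betaS].
Proof.
(* [S], coerced to the type of its elements, takes the place of [T]. *)
move=> _ _; exists (Topological.class (beta S)).
by split; [exact: open_betaE | exact: compact_beta | exact: hausdorff_beta].
Qed.
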